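(* For every $\varepsilon>0$ there exists a measurable set $E\subset[0,1]$ with $\lambda(E)>1-\varepsilon$ such that almost every similar copy of almost every infinite geometric progression is not contained in $E$; that is, $$\lambda\bigl(\{(r,a,b)\in(0,1)\times(\mathbb{R}\setminus\{0\})\times\mathbb{R} : ar^n+b\in E \text{ for all } n\in\mathbb{N}\}\bigr)=0.$$
   Context: $\lambda$ denotes Lebesgue measure (on $\mathbb{R}$, respectively on $\mathbb{R}^3$), and ''measurable'' means Lebesgue measurable. *)

(* Defs.v *)
From HB Require Import structures.
From mathcomp Require Import all_boot all_order all_algebra.
From mathcomp Require Import all_classical all_reals all_analysis.

Set Implicit Arguments.
Unset Strict Implicit.
Unset Printing Implicit Defensive.

Import Order.TTheory GRing.Theory Num.Theory.

Local Open Scope classical_set_scope.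
Local Open Scope ring_scope.

(* The library's [measurable] on R denotes the Borel sigma-algebra. The Lebesgue
   sigma-algebra is the domain of [completed_lebesgue_measure], i.e. the
   Caratheodory measurable sets; they are the unions of a Borel set and a null
   set by [completed_caratheodory_measurable]. *)
Definition lebesgue_measurable (R : realType) (E : set R) : Prop :=
  ((@wlength R idfun)^*)%mu.-cara.-measurable E.

(* On R^3, [\x] gives the measure on the product Borel sigma-algebra only; it
   is completed in the same way as [completed_lebesgue_measure]. The result is
   an outer measure, total on [set (R * R * R)], so that a set of value 0 is in
   particular Lebesgue measurable. *)
Definition completed_lebesgue_measure3 (R : realType) :
    set (R * R * R) -> \bar R :=
  @completed_measure_extension _ _ R
    ((@lebesgue_measure R \x @lebesgue_measure R) \x @lebesgue_measure R)%E.

(* Main.v *)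
Require Import Defs.
From mathcomp Require Import all_boot all_order all_algebra.
From mathcomp Require Import all_classical all_reals all_analysis.
From mathcomp Require Import ring lra measurable_realfun.

(** Write [teeth d] for the 1-periodic union of the intervals [[i, i + d[],
    [i] an integer. The set [E] is [[0, 1[] minus the sets of [x] with
    [N_k * x] in [teeth d_k], where the densities [d_k] have total less than
    [eps] and the frequencies [N_k] are very large. Its measure is more than
    [1 - eps] because the [k]-th removed set has measure [d_k] in [[0, 1[].

    In fact, for every ratio [r] in [(0, 1)] and every [b], the set of
    scales [a] for which the whole progression stays in [E] is null; the
    theorem follows by integrating over [a] before [r] and [b]
    ([product_measure_middle_sections0]).

    For fixed [r], [b] and [k], the condition on [a] given by the [n]-th term
    is periodic with period [1 / (N_k * r ^ n)] and discards a proportion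
    [d_k] of the scales. Take only exponents [n] that are multiples of some
    [L] with [r ^ L <= d_k / 8]: the periods then grow so fast that inside each
    period of one condition the previous ones are already equidistributed up to
    an error proportional to [d_k], so each condition multiplies the surviving
    proportion by at most [1 - d_k / 2] ([sparse_teeth]). With [J] conditions at
    most a proportion [(1 - d_k / 2) ^ J] of the scales survives
    ([sparse_lacunary]). Although [d_k] tends to 0, [J] may be as large as
    desired, provided that [N_k] is large enough for all [J] periods to be
    shorter than 1. One [N_k] serves all [r] that are at least [1 / (k + 1)],
    with surviving proportion at most [1 / (k + 1)]
    ([progression_meets_teeth]). Letting [k] tend to infinity gives a null set
    ([sparse_null]). *)

Import Order.TTheory GRing.Theory Num.Theory.

Local Open Scope classical_set_scope.
Local Open Scope ring_scope.

(** * Periodic sets of intervals *)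

Definition teeth {R : realType} (d : R) : set R :=
  [set t | t - (Num.floor t)%:~R < d].

Lemma teethE {R : realType} (d : R) : d <= 1 ->
  teeth d = \bigcup_(i : int) `[i%:~R, (i%:~R + d)%R[%classic.
Proof.
move=> d1; apply/seteqP; split=> t; rewrite /teeth/=.
  by move=> td; exists (Num.floor t) => //=;
    rewrite in_itv/= floor_le/= -ltrBlDl.
move=> [i _]; rewrite /= in_itv/= => /andP[it ti].
rewrite (@floor_def _ _ i) ?it ?intrD/=; lra.
Qed.

Lemma measurable_teeth {R : realType} (d : R) : d <= 1 -> measurable (teeth d).
Proof.
move=> d1; rewrite teethE//.
by apply: countable_bigcupT_measurable => //.
Qed.

Lemma measurable_affine_preimage {R : realType} (u v : R) (A : set R) :
  measurable A -> measurable [set a : R | A (u * a + v)].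
Proof.
move=> mA; rewrite -[X in measurable X]setTI.
suff : measurable_fun setT (fun a : R => u * a + v) by apply.
by apply: measurable_funD => //; apply: measurable_funM.
Qed.

(** As [N] is an integer, [[0, 1[] consists of exactly [N] full periods. *)
Lemma measure_teeth_unit {R : realType} (d : R) (N : nat) :
  0 < d <= 1 -> (0 < N)%N ->
  (lebesgue_measure ([set x : R | teeth d (N%:R * x)%R] `&` `[0%R, 1%R[)
    <= d%:E)%E.
Proof.
move=> /andP[d0 d1] N0.
have NR0 : 0 < N%:R :> R by rewrite ltr0n.
pose I (j : nat) : set R := `[j%:R / N%:R, (j%:R / N%:R + d / N%:R)%R[%classic.
apply: (@le_trans _ _ (\sum_(j < N) lebesgue_measure (I j))%E).
  apply: (@content_subadditive _ _ _ (@lebesgue_measure R)) => [j _||].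
  - exact: measurable_itv.
  - apply: measurableI => //.
    have := @measurable_affine_preimage R N%:R 0 _ (measurable_teeth d d1).
    by under eq_set do rewrite addr0.
  - move=> x [/=]; rewrite /teeth/= => td; rewrite in_itv/= => /andP[x0 x1].
    have Nx0 : 0 <= N%:R * x by rewrite mulr_ge0// ltW.
    have Nx1 : N%:R * x < N%:R by rewrite gtr_pMr.
    set j := Num.truncn (N%:R * x).
    have /andP[jl jg] := truncn_itv Nx0.
    have fE : Num.floor (N%:R * x) = j%:Z.
      by apply: floor_def; rewrite intrD/= natr1 jl.
    move: td; rewrite fE /= => td.
    rewrite -bigcup_mkord; exists j.
      by rewrite /= -(ltr_nat R) (le_lt_trans jl).
    rewrite /I /= in_itv/= -mulrDl ler_pdivrMr// ltr_pdivlMr//.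
    by apply/andP; split; lra.
apply: (@le_trans _ _ (\sum_(j < N) (d / N%:R)%:E)%E).
  apply: lee_sum => j _; rewrite /I lebesgue_measure_itv/= lte_fin.
  case: ifP => _; first by rewrite -EFinB lee_fin; lra.
  by rewrite lee_fin divr_ge0// ltW.
rewrite sumEFin lee_fin sumr_const card_ord -[leLHS]mulr_natr divfK//.
by rewrite gt_eqF.
Qed.

(** * Surviving proportion under lacunary periodic conditions *)

(** A bound by [c] on the proportion of [A] in every interval, at all scales
    from [l] upwards. Uniformity in the position and in the length is what makes
    the bound usable inside each gap of a periodic set. *)
Definition sparse {R : realType} (A : set R) (l c : R) := forall x k : R,
  l <= k -> (lebesgue_measure (A `&` `[x, (x + k)%R[) <= (c * k)%:E)%E.

(** Within one period the survivors of the new condition form an interval of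
    length [(1 - d) / u], at least half a period, where [A] has proportion at
    most [c]. An interval of length [k] meets at most [u * k + 2] periods; as
    [k >= 4 / (d * u)], the two extra periods have length [2 / u <= d * k / 2],
    and [(1 - d) * (1 + d / 2) <= 1 - d / 2]. *)
Lemma sparse_teeth {R : realType} (A : set R) (u v c d : R) :
  measurable A -> 0 < u -> 0 <= c -> 0 < d <= 2^-1 ->
  sparse A (2 * u)^-1 c ->
  sparse (A `&` [set a | ~ teeth d (u * a + v)])
    (4 / (d * u)) ((1 - d / 2) * c).
Proof.
move=> mA u0 c0 /andP[d0 d2] sA x k kl.
pose i0 := Num.floor (u * x + v).
pose m := (Num.truncn (u * k)).+2.
pose y (j : nat) : R := (i0%:~R + j%:R + d - v) / u.
pose P j := A `&` `[y j, y j + (1 - d) / u[.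
have k0 : 0 < k by apply: lt_le_trans kl; rewrite divr_gt0// mulr_gt0.
have uk0 : 0 <= u * k by rewrite mulr_ge0// ltW.
have i0l : i0%:~R <= u * x + v by exact: floor_le.
have i0g : u * x + v < i0%:~R + 1.
  by have /andP[_] := floor_itv (u * x + v); rewrite intrD.
have mP j : measurable (P j) by apply: measurableI.
have mB : measurable (A `&` [set a | ~ teeth d (u * a + v)] `&` `[x, x + k[).
  apply: measurableI => //; apply: measurableI => //.
  apply: (@measurable_affine_preimage R u v (~` teeth d)).
  by apply: measurableC; apply: measurable_teeth; lra.
apply: (@le_trans _ _ (\sum_(j < m) lebesgue_measure (P j))%E).
  apply: (@content_subadditive _ _ _ (@lebesgue_measure R)) => [j _|//|].
    exact: mP.
  (* A surviving [a] lies in the gap of the period that contains it, and that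
     period is one of the [m] that start at the one containing [x]. *)
  move=> a [[Aa]]; rewrite /teeth/= => nta; rewrite in_itv/= => /andP[xa axk].
  set f := Num.floor (u * a + v) in nta.
  have fl : f%:~R <= u * a + v by exact: floor_le.
  have fg : u * a + v < f%:~R + 1.
    by have /andP[_] := floor_itv (u * a + v); rewrite intrD.
  have xa' : u * x + v <= u * a + v by rewrite lerD2r ler_pM2l.
  have i0f : i0 <= f by exact: le_floor.
  have [j jE] : exists j : nat, f = i0 + j%:Z.
    by exists `|f - i0|%N; rewrite gez0_abs ?subr_ge0// addrCA subrr addr0.
  have fE : f%:~R = i0%:~R + j%:R :> R by rewrite jE intrD.
  rewrite -bigcup_mkord; exists j.
    rewrite /= /m -ltnS -(ltr_nat R) -natr1 -ltrBrDr.
    have := truncnS_gt (u * k); rewrite -natr1.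
    have : u * a < u * (x + k) by rewrite ltr_pM2l.
    rewrite /= -2!natr1; lra.
  split => //=; rewrite in_itv/= /y -mulrDl ler_pdivrMr// ltr_pdivlMr//.
  apply/andP; split; nra.
have Pj j : (lebesgue_measure (P j) <= (c * ((1 - d) / u))%:E)%E.
  apply: sA; rewrite invfM ler_pM2r ?invr_gt0//; lra.
apply: (@le_trans _ _ (\sum_(j < m) (c * ((1 - d) / u))%:E)%E).
  exact: lee_sum.
rewrite sumEFin lee_fin sumr_const card_ord -[leLHS]mulr_natr.
have mk : m%:R <= u * k + 2.
  rewrite /m -2!natr1; have := truncn_itv uk0; lra.
have -> : c * ((1 - d) / u) * m%:R = c * ((1 - d) * m%:R / u) by ring.
rewrite [leRHS]mulrAC [leRHS]mulrC ler_wpM2l// ler_pdivrMr//.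
move: kl; rewrite ler_pdivrMr ?mulr_gt0// => kl; nra.
Qed.

Lemma sparse_le {R : realType} (A B : set R) (l m c e : R) :
  A `<=` B -> l <= m -> c <= e -> 0 <= m -> sparse B l c -> sparse A m e.
Proof.
move=> AB lm ce m0 sB x k mk.
apply: (@le_trans _ _ (c * k)%:E).
  apply: le_trans (sB x k (le_trans lm mk)).
  by apply: le_outer_measure; exact: setSI.
by rewrite lee_fin ler_wpM2r// (le_trans m0).
Qed.

(** The factor 8 is what the induction on [J] requires: one condition yields a
    bound from scale [4 / (d * u J)] on, and the next condition needs it from
    scale [1 / (2 * u J.+1)] on. *)
Lemma sparse_lacunary {R : realType} (d : R) (u v : nat -> R) (J : nat) :
  0 < d <= 2^-1 -> (forall j, 0 < u j) ->
  (forall j, u j.+1 <= d / 8 * u j) ->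
  sparse [set a | forall j, (j < J)%N -> ~ teeth d (u j * a + v j)]
    (2 * u J)^-1 ((1 - d / 2) ^+ J).
Proof.
move=> d02 u0 uS; have /andP[d0 d2] := d02.
pose A K := [set a | forall j, (j < K)%N -> ~ teeth d (u j * a + v j)].
suff [] : measurable (A J) /\
  sparse (A J) (2 * u J)^-1 ((1 - d / 2) ^+ J) by [].
elim: J => [|J [mA sA]].
  have -> : A 0%N = setT by apply/seteqP; split.
  split => // x k uk; rewrite setTI lebesgue_measure_itv /= lte_fin.
  have k0 : 0 < k by apply: lt_le_trans uk; rewrite invr_gt0 mulr_gt0.
  by rewrite ltrDl k0 -EFinB lee_fin; lra.
have -> : A J.+1 = A J `&` [set a | ~ teeth d (u J * a + v J)].
  apply/seteqP; split=> [a Aa|a [Aa nt] j].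
    by split=> [j jJ|]; apply: Aa => //; exact: ltnW.
  by rewrite ltnS leq_eqVlt => /predU1P[->//|]; exact: Aa.
split.
  apply: measurableI => //.
  apply: (@measurable_affine_preimage R (u J) (v J) (~` teeth d)).
  by apply: measurableC; apply: measurable_teeth; lra.
move=> x k uk; rewrite exprS; apply: sparse_teeth => //.
  by apply: exprn_ge0; lra.
apply: le_trans uk.
rewrite ler_pdivrMr ?mulr_gt0// mulrC ler_pdivlMr ?mulr_gt0//.
by have := uS J; lra.
Qed.

(** * Progressions avoiding a fine periodic set *)

Lemma exists_expr_le {R : realType} (q e : R) : 0 <= q < 1 -> 0 < e ->
  exists n, q ^+ n <= e.
Proof.
move=> /andP[q0 q1] e0.
have : q ^+ n @[n --> \oo] --> 0 by apply: cvg_expr; rewrite ger0_norm.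
move=> /cvgrPdist_le /(_ _ e0) [n _ H]; exists n; move: (H n (leqnn n)).
by rewrite /= sub0r normrN ger0_norm ?exprn_ge0.
Qed.

(** The lower bound keeps the periods used below under control: too large an
    exponent would make them longer than the intervals considered. *)
Lemma exists_expr_window {R : realType} (r e : R) : 0 < r < 1 -> 0 < e < 1 ->
  exists n, r * e <= r ^+ n <= e.
Proof.
move=> /andP[r0 r1] /andP[e0 e1].
have ex : exists n, r ^+ n <= e by apply: exists_expr_le => //; rewrite ltW.
case: (ex_minnP ex) => -[|n] ne nmin.
  by move: ne; rewrite expr0; lra.
exists n.+1.
rewrite ne andbT exprS ler_pM2l// leNgt; apply/negP => /ltW /nmin.
by rewrite ltnn.
Qed.

(** The lacunary bound is applied to the terms of exponent [L * j], [j < J],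
    where [r ^ L] is just below [d / 8]. Since [r >= eta], the slowest of these
    terms has frequency at least [N * (eta * d / 8) ^ J], which is at least 1
    for an [N] independent of [r] and [b]. *)
Lemma progression_meets_teeth {R : realType} (d eta : R) :
  0 < d <= 2^-1 -> 0 < eta ->
  exists2 N : nat, (0 < N)%N & forall r b : R, eta <= r < 1 ->
  sparse [set a | forall n : nat, ~ teeth d (N%:R * (a * r ^+ n + b))] 1 eta.
Proof.
move=> d02 eta0; have /andP[d0 d2] := d02.
have [J JP] : exists J, (1 - d / 2) ^+ J <= eta.
  by apply: exists_expr_le => //; lra.
pose s : R := eta * (d / 8).
have s0 : 0 < s by rewrite /s mulr_gt0//; lra.
exists (Num.truncn (s ^- J)).+1 => // r b /andP[er r1].
set N := _.+1.
have r0 : 0 < r by exact: lt_le_trans er.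
have NJ : 1 <= N%:R * s ^+ J.
  by rewrite -ler_pdivrMr ?exprn_gt0// mul1r ltW// truncnS_gt.
have [||L /andP[rL Lr]] := @exists_expr_window R r (d / 8).
- by rewrite r0.
- by apply/andP; split; lra.
have rLJ : 1 <= N%:R * (r ^+ L) ^+ J.
  apply: le_trans NJ _; rewrite ler_wpM2l// lerXn2r ?nnegrE ?exprn_ge0//.
  - exact: ltW.
  - exact: ltW.
  - by apply: le_trans rL; rewrite ler_wpM2r//; lra.
have H := @sparse_lacunary R d (fun j => N%:R * (r ^+ L) ^+ j)
  (fun=> N%:R * b) J d02.
apply: (@sparse_le _ _ _ _ _ _ _ _ _ JP ler01 (H _ _)).
- move=> a /= nt j _.
  by have := nt (L * j)%N; rewrite exprM mulrDr [a * _]mulrC mulrA.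
- rewrite invf_le1; lra.
- by move=> j; rewrite mulr_gt0// !exprn_gt0.
- by move=> j; rewrite exprS mulrCA ler_wpM2r// mulr_ge0// !exprn_ge0// ltW.
Qed.

Lemma sparse_null {R : realType} (A : set R) : measurable A ->
  (forall eta, 0 < eta -> sparse A 1 eta) -> lebesgue_measure A = 0%E.
Proof.
move=> mA sA.
pose B n := A `&` `[- n%:R, (- n%:R + (n.+1 + n.+1)%:R)%R[.
have AE : A = \bigcup_n B n.
  apply/seteqP; split=> [a Aa|a [n _ []//]].
  exists (Num.truncn `|a|).+1 => //; split => //=.
  rewrite in_itv/= !natrD -!natr1.
  have := truncnS_gt `|a|; rewrite -natr1 ltr_norml => /andP[].
  by move=> ? ?; apply/andP; split; lra.
suff : (lebesgue_measure (\bigcup_n B n) <= 0)%E.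
  by rewrite -AE measure_le0 => /eqP.
apply: le_trans (generalized_Boole_inequality _ _ _) _.
- by move=> n; apply: measurableI.
- by rewrite -AE.
rewrite eseries0//= => n _ _.
apply/eqP; rewrite -measure_le0.
apply/lee_addgt0Pr => e e0; rewrite add0e.
rewrite /B; set k : R := (n.+1 + n.+1)%:R.
have k1 : 1 <= k by rewrite /k ler1n.
have k0 : 0 < k by lra.
apply: le_trans (sA (e / k) _ (- n%:R) k k1) _; first by rewrite divr_gt0.
by rewrite divfK// gt_eqF.
Qed.

(** * Null sets in a triple product *)

Lemma product_measure_ysection0 d1 d2 (T1 : measurableType d1)
    (T2 : measurableType d2) (R : realType)
    (m1 : {sigma_finite_measure set T1 -> \bar R})
    (m2 : {sigma_finite_measure set T2 -> \bar R}) (S : set (T1 * T2)) :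
  measurable S -> (forall y, m1 (ysection S y) = 0%E) -> (m1 \x m2)%E S = 0%E.
Proof.
move=> mS S0; transitivity ((m1 \x^ m2)%E S).
  by apply: product_measure_unique => //= *; rewrite product_measure2E.
by apply: integral0_eq => y _; exact: S0.
Qed.

(** The definition of the product measure integrates over the last variable
    first. Tonelli turns the outer integral over pairs into an iterated one, and
    for fixed [x] the order of [y] and [z] is exchanged in the plane. *)
Lemma product_measure_middle_sections0 d1 d2 d3 (T1 : measurableType d1)
    (T2 : measurableType d2) (T3 : measurableType d3) (R : realType)
    (m1 : {sigma_finite_measure set T1 -> \bar R})
    (m2 : {sigma_finite_measure set T2 -> \bar R})
    (m3 : {sigma_finite_measure set T3 -> \bar R}) (S : set (T1 * T2 * T3)) :
  measurable S -> (forall x z, m2 [set y | S (x, y, z)] = 0%E) ->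
  ((m1 \x m2) \x m3)%E S = 0%E.
Proof.
move=> mS S0.
rewrite /product_measure1 fubini_tonelli1; first last.
- by [].
- exact: measurable_fun_xsection.
apply: integral0_eq => x _; rewrite /fubini_F.
have mSx : measurable [set yz : T2 * T3 | S (x, yz.1, yz.2)].
  rewrite -[X in measurable X]setTI.
  suff : measurable_fun setT (fun yz : T2 * T3 => (x, yz.1, yz.2)) by apply.
  by apply: measurable_fun_pair => //; apply: measurable_fun_pair.
rewrite -[RHS](@product_measure_ysection0 _ _ _ _ _ m2 m3 _ mSx).
  by apply: eq_integral => y _ /=; congr (m3 _).
move=> z; rewrite -(S0 x z); congr (m2 _).
by apply/seteqP; split => y; rewrite /ysection/= inE.
Qed.

(** * The exceptional set *)

Lemma measurable_progression_in {R : realType} (E : set R) : measurable E ->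
  measurable [set x : R * R * R | let '(r, a, b) := x in
    [/\ 0 < r < 1, a != 0 & forall n : nat, E (a * r ^+ n + b)]].
Proof.
move=> mE.
have -> : [set x : R * R * R | let '(r, a, b) := x in
      [/\ 0 < r < 1, a != 0 & forall n : nat, E (a * r ^+ n + b)]] =
    (fun x : R * R * R => x.1.1) @^-1` `]0, 1[ `&`
    ((fun x : R * R * R => x.1.2) @^-1` (~` [set 0]) `&`
     \bigcap_n ((fun x : R * R * R => x.1.2 * x.1.1 ^+ n + x.2) @^-1` E)).
  apply/seteqP; split=> -[[r a] b] /=; rewrite in_itv/=.
    by case=> r01 /eqP a0 Ex; split => //; split => // n _; exact: Ex.
  case=> r01 [/eqP a0 Ex]; split => // n; exact: Ex.
have m1 : measurable_fun setT (fun x : R * R * R => x.1.1).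
  exact: (measurableT_comp measurable_fst measurable_fst).
have m2 : measurable_fun setT (fun x : R * R * R => x.1.2).
  exact: (measurableT_comp measurable_snd measurable_fst).
have pre (f : R * R * R -> R) (B : set R) : measurable_fun setT f ->
    measurable B -> measurable (f @^-1` B).
  by move=> mf mB; rewrite -[X in measurable X]setTI; exact: mf.
apply: measurableI; first exact: pre.
apply: measurableI; first by apply: pre => //; apply: measurableC.
apply: bigcap_measurable => [|n _]; first by exists 0%N.
apply: pre => //; apply: measurable_funD => //.
by apply: measurable_funM => //; apply: measurable_funX.
Qed.

(** Almost every scale is excluded for every [r] and [b], not only for almost
    every one; for given [eta], the stage [k] with [1 / (k + 1) < min(r, eta)]
    bounds the proportion of surviving scales by [eta]. *)
Lemma exists_large_progression_avoiding {R : realType} (eps : R) : 0 < eps ->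
  exists E : set R, [/\ E `<=` `[0, 1[, measurable E,
    ((1 - eps)%:E < lebesgue_measure E)%E &
    forall r b : R, 0 < r < 1 ->
      lebesgue_measure [set a | forall n : nat, E (a * r ^+ n + b)] = 0%E].
Proof.
move=> eps0.
(* The minimum with 1 ensures [d k <= 1 / 2] when [eps] is large. *)
pose e := Num.min eps 1 / 2.
have [e0 e1 e_eps] : [/\ 0 < e, e <= 2^-1 & e < eps].
  by rewrite /e; case: (leP eps 1) => ?; split; lra.
pose d k : R := e / (2 ^ k.+1)%:R.
have d02 k : 0 < d k <= 2^-1.
  rewrite /d divr_gt0 ?ltr0n ?expn_gt0//=.
  rewrite ler_pdivrMr ?ltr0n ?expn_gt0//.
  by apply: le_trans e1 _; rewrite ler_peMr// ler1n expn_gt0.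
have d01 k : 0 < d k <= 1.
  by have /andP[-> dk] := d02 k; rewrite (le_trans dk)// invf_le1//; lra.
have /choice[N /all_and2[N0 NP]] : forall k, exists N : nat, (0 < N)%N /\
    forall r b : R, k.+1%:R^-1 <= r < 1 ->
    sparse [set a | forall n, ~ teeth (d k) (N%:R * (a * r ^+ n + b))]
      1 k.+1%:R^-1.
  move=> k; have [||N N0 NP] := @progression_meets_teeth R (d k) k.+1%:R^-1.
  - exact: d02.
  - by rewrite invr_gt0.
  - by exists N.
pose F k : set R := [set x | teeth (d k) ((N k)%:R * x)].

have mF k : measurable (F k).
  have /andP[_ dk1] := d01 k.
  have := @measurable_affine_preimage R (N k)%:R 0 _ (measurable_teeth _ dk1).
  by under eq_set do rewrite addr0.
pose G := \bigcup_k (F k `&` `[0, 1[).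
have mFI k : measurable (F k `&` `[0, 1[) by exact: measurableI.
have mG : measurable G by apply: bigcup_measurable => k _; exact: mFI.
have mE : measurable (`[0, 1[ `\` G) by exact: measurableD.
exists (`[0, 1[ `\` G); split => //.
- have G_e : (lebesgue_measure G <= e%:E)%E.
    apply: (le_trans (@generalized_Boole_inequality _ _ _
      (@lebesgue_measure R) (fun k => F k `&` `[0, 1[) _ mG)).
      exact: mFI.
    apply: le_trans (epsilon_trick0 _ (ltW e0)).
    apply: lee_nneseries => [k _ _|k _]; first exact: measure_ge0.
    exact: measure_teeth_unit.
  have : (1%:E <= lebesgue_measure (`[0%R, 1%R[ `\` G) + e%:E)%E.
    apply: le_trans (leeD2l _ G_e).
    apply: le_trans (measureU2 _ _ _) => //.
    have -> : (1%:E = lebesgue_measure (`[0%R, 1%R[ : set R))%E.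
      by rewrite lebesgue_measure_itv/= lte_fin ltr01 -EFinB subr0.
    apply: le_measure; rewrite ?inE//; first exact: measurableU.
    by move=> x x01; have [Gx|nGx] := pselect (G x); [right|left].
  rewrite -leeBlDr// -EFinB; apply: lt_le_trans.
  by rewrite lte_fin; lra.
- move=> r b /andP[r0 r1].
  apply: sparse_null.
    rewrite [X in measurable X](_ : _ = \bigcap_n
        [set a | (`[0, 1[ `\` G) (r ^+ n * a + b)]).
      apply: bigcap_measurable => [|n _]; first by exists 0%N.
      exact: measurable_affine_preimage.
    apply/seteqP; split=> [a Ea n _|a Ea n] /=; rewrite mulrC; first exact: Ea.
    exact: Ea.
  move=> eta eta0.
  have [k kP] : exists k : nat, k.+1%:R^-1 < Num.min r eta.
    have m0 : 0 < Num.min r eta by rewrite lt_min r0.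
    exists (Num.truncn (Num.min r eta)^-1).
    by rewrite invf_plt ?posrE// truncnS_gt.
  move: kP; rewrite lt_min => /andP[kr keta].
  apply: (@sparse_le R _ _ 1 1 _ _ _ _ _ _ (NP k r b _)) => //.
  - move=> a Ea n ht; have [x01 nG] := Ea n.
    by apply: nG; exists k.
  - exact: ltW.
  - by rewrite (ltW kr).
Qed.

Theorem proposition3p4 (R : realType) (eps : R) (eps_gt0 : 0 < eps) :
  exists E : set R,
    [/\ E `<=` `[0, 1],
        lebesgue_measurable E,
        ((1 - eps)%:E < completed_lebesgue_measure E)%E &
        completed_lebesgue_measure3
          [set x : R * R * R | let '(r, a, b) := x in
             [/\ 0 < r < 1, a != 0 &
                 forall n : nat, E (a * r ^+ n + b)]] = 0%E].
Proof.
have [E [E01 mE measE E0]] := exists_large_progression_avoiding eps eps_gt0.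
have mS := measurable_progression_in E mE.
exists E; split => //.
- move=> x /E01 /=; rewrite !in_itv/= => /andP[-> /ltW]; exact.
- exact: sub_caratheodory.
rewrite /completed_lebesgue_measure3 /completed_measure_extension.
rewrite measurable_mu_extE//.
apply: product_measure_middle_sections0 => // r b /=.
have [r01|r01] := boolP (0 < r < 1); last first.
  by rewrite (_ : [set _ | _] = set0) ?measure0//; apply/seteqP; split => a [].
apply/eqP; rewrite -measure_le0 -(E0 r b r01).
apply: le_outer_measure => a [_ _]; exact.
Qed.
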